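(* Let $n\ge1$, let $\sigma,\tau,\pi\in\mathcal{D}_n$, and let $f$ be an oriented TFPL configuration with boundaries $\sigma,\tau,\pi$. For $i\in\{1,\dots,2n-1\}$ let $N_i(f)$ be the number of oriented edges of $f$ that are directed from a vertex of $O_i$ to a vertex of $E_i$, and set $N_0(f)=0$. Then $$N_i(f)-N_{i-1}(f)=\pi_i-\sigma_i\qquad\text{for } i=1,\dots,2n-1.$$
   Context: $\mathcal{D}_n$ is the set of words $\sigma=\sigma_1\cdots\sigma_{2n}$ on the alphabet $\{0,1\}$ with $n$ zeros and $n$ ones such that each prefix contains at least as many $0$s as $1$s. **The triangle.** $\mathcal{T}^n$ is the graph with vertices $(x,y)\in\mathbb{Z}^2$, $x\ge y\ge 0$, $x+y\le 4n-2$, with all unit horizontal and vertical edges between these vertices, together with $2n$ external (half-)edges: the $i$th one hangs vertically below the vertex $(2i-2,0)$, $i=1,\dots,2n$, and is attached to this vertex only. The left boundary vertices are $L_i=(i-1,i-1)$ and the right boundary vertices are $R_i=(2n-2+i,2n-i)$, $i=1,\dots,2n$ (so $L_{2n}=R_1$). For $i\in\{1,\dots,2n\}$, $E_i$ is the set of vertices of $\mathcal{T}^n$ with $x+y=2i-2$; for $i\in\{1,\dots,2n-1\}$, $O_i$ is the set of vertices with $x+y=2i-1$. **Oriented TFPL configurations.** For $\sigma,\tau,\pi\in\mathcal{D}_n$, an oriented TFPL configuration with boundaries $\sigma,\tau,\pi$ is a subgraph $f$ of $\mathcal{T}^n$ with an orientation of each of its edges, such that: - all $2n$ external edges belong to $f$,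 the $i$th one being oriented upwards if $\pi_i=0$ and downwards if $\pi_i=1$; - for $1\le i\le 2n-1$ the horizontal edge from $L_i$ to its right neighbour is in $f$, oriented to the right; for $2\le i\le 2n$ the vertical edge just below $L_i$ is in $f$ if and only if $\sigma_i=0$, and is then oriented upwards; - for $2\le i\le 2n$ the horizontal edge between $R_i$ and its left neighbour is in $f$, oriented to the right; for $1\le i\le 2n-1$ the vertical edge just below $R_i$ is in $f$ if and only if $\tau_i=1$, and is then oriented downwards; - every vertex other than the $L_i$ and $R_i$ has exactly one incoming and exactly one outgoing edge in $f$. (No condition on how paths connect the boundary points is imposed.) *)

(* Defs.v *)
From HB Require Import structures.
From mathcomp Require Import all_boot all_order all_algebra.
From mathcomp Require Import finmap.

Set Implicit Arguments.
Unset Strict Implicit.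
Unset Printing Implicit Defensive.

Import Order.TTheory GRing.Theory Num.Theory.
Local Open Scope ring_scope.

(** A word on {0,1} is a [seq bool], [false] standing for the letter 0 and
    [true] for the letter 1. *)
Definition dyck (n : nat) (w : seq bool) : Prop :=
  [/\ count_mem false w = n,
      count_mem true w = n &
      forall k : nat,
        (count_mem true (take k w) <= count_mem false (take k w))%N].

(** Words are indexed from 1; the default value of [nth] is never reached for
    [1 <= i <= size w]. *)
Definition letter (w : seq bool) (i : nat) : nat := nth false w i.-1.

Definition point : Type := (int * int)%type.
Definition dart : Type := (point * point)%type.

Definition right_of (p : point) : point := (p.1 + 1, p.2).
Definition left_of (p : point) : point := (p.1 - 1, p.2).
Definition below (p : point) : point := (p.1, p.2 - 1).

Definition vertex (n : nat) (p : point) : bool :=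
  [&& p.2 <= p.1, 0 <= p.2 & p.1 + p.2 <= 4 * n%:Z - 2].

Definition base (i : nat) : point := (2 * i%:Z - 2, 0).

Definition internal_edge (n : nat) (u v : point) : bool :=
  [&& vertex n u, vertex n v & `|u.1 - v.1| + `|u.2 - v.2| == 1].

(** The [i]th external half-edge is attached to [base i] only: its free end
    is represented by the point [below (base i)], of ordinate -1, which is
    not a vertex of the triangle. *)
Definition external_edge (n : nat) (u v : point) : Prop :=
  exists2 i : nat, (1 <= i <= 2 * n)%N &
    (u, v) = (base i, below (base i)) \/
    (u, v) = (below (base i), base i).

Definition edge (n : nat) (u v : point) : Prop :=
  internal_edge n u v \/ external_edge n u v.

Definition vL (i : nat) : point := (i%:Z - 1, i%:Z - 1).
Definition vR (n i : nat) : point := (2 * n%:Z - 2 + i%:Z, 2 * n%:Z - i%:Z).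

Definition vE (n i : nat) (p : point) : bool :=
  vertex n p && (p.1 + p.2 == 2 * i%:Z - 2).
Definition vO (n i : nat) (p : point) : bool :=
  vertex n p && (p.1 + p.2 == 2 * i%:Z - 1).

(** A subgraph with an orientation of each of its edges is the finite set of
    its oriented edges: [(u, v)] is the edge between [u] and [v], oriented
    from [u] to [v]. *)
Definition oriented_subgraph (n : nat) (f : {fset dart}) : Prop :=
  forall u v : point, (u, v) \in f -> edge n u v /\ (v, u) \notin f.

Definition has_edge (f : {fset dart}) (u v : point) : bool :=
  ((u, v) \in f) || ((v, u) \in f).

Definition indegree (f : {fset dart}) (p : point) : nat :=
  #|` [fset a in f | a.2 == p]%fset|.
Definition outdegree (f : {fset dart}) (p : point) : nat :=
  #|` [fset a in f | a.1 == p]%fset|.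

Record oriented_tfpl (n : nat) (sigma tau pi : seq bool) (f : {fset dart})
    : Prop := OrientedTFPL {
  tfpl_subgraph : oriented_subgraph n f;
  tfpl_external : forall i : nat, (1 <= i <= 2 * n)%N ->
    [/\ has_edge f (below (base i)) (base i),
        letter pi i = 0%N -> (below (base i), base i) \in f &
        letter pi i = 1%N -> (base i, below (base i)) \in f];
  tfpl_left_horizontal : forall i : nat, (1 <= i <= 2 * n - 1)%N ->
    (vL i, right_of (vL i)) \in f;
  tfpl_left_vertical : forall i : nat, (2 <= i <= 2 * n)%N ->
    (has_edge f (below (vL i)) (vL i) <-> letter sigma i = 0%N) /\
    (has_edge f (below (vL i)) (vL i) -> (below (vL i), vL i) \in f);
  tfpl_right_horizontal : forall i : nat, (2 <= i <= 2 * n)%N ->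
    (left_of (vR n i), vR n i) \in f;
  tfpl_right_vertical : forall i : nat, (1 <= i <= 2 * n - 1)%N ->
    (has_edge f (below (vR n i)) (vR n i) <-> letter tau i = 1%N) /\
    (has_edge f (below (vR n i)) (vR n i) -> (vR n i, below (vR n i)) \in f);
  tfpl_degrees : forall p : point, vertex n p ->
    (forall i : nat, (1 <= i <= 2 * n)%N -> p <> vL i /\ p <> vR n i) ->
    indegree f p = 1%N /\ outdegree f p = 1%N
}.

Definition num_OE (n : nat) (f : {fset dart}) (i : nat) : nat :=
  if i == 0%N then 0%N
  else #|` [fset a in f | vO n i a.1 && vE n i a.2]%fset|.

(* Main.v *)
(** Count the oriented edges ending on [E_i] in two ways: vertex by vertex
    there are [i - sigma_i] of them, while by origin they come from [O_(i-1)],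
    from [O_i], or, when [pi_i = 0], from the external edge below [base i].
    The edges leaving [O_(i-1)] number [i - 1] and end in [E_(i-1)] or [E_i].
    Eliminating the edges from [O_(i-1)] to [E_i] gives the recurrence
    for [i >= 2]; for [i = 1] both sides vanish, as Dyck words start with 0. *)
Require Import Defs.
From HB Require Import structures.
From mathcomp Require Import all_boot all_order all_algebra.
From mathcomp Require Import finmap.
From mathcomp Require Import zify.

Set Implicit Arguments.
Unset Strict Implicit.
Unset Printing Implicit Defensive.

Import Order.TTheory GRing.Theory Num.Theory.
Local Open Scope ring_scope.

Lemma card_fset_sum (T : choiceType) (f : {fset T}) (P : pred T) :
  #|` [fset a in f | P a]%fset| = (\sum_(a <- f) P a)%N.
Proof.
rewrite card_fset_sum1 big_fset /= big_mkcond /=.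
by apply: eq_bigr => a _; case: (P a).
Qed.

Lemma sum_eq_mem (T : choiceType) (f : {fset T}) (d : T) :
  (\sum_(a <- f) (a == d))%N = (d \in f).
Proof.
rewrite -(count_uniq_mem d (fset_uniq f)) -sum1_count.
by rewrite [RHS]big_mkcond; apply: eq_bigr => a _ /=; case: eqP.
Qed.

Lemma letter_le1 w i : (letter w i <= 1)%N.
Proof. exact: leq_b1. Qed.

Lemma dyck_letter1 n w : dyck n w -> letter w 1 = 0%N.
Proof. by case=> _ _ /(_ 1%N); case: w => [|[] w] //=; rewrite take0. Qed.

(** For [k < i], these points enumerate E_i when [s = 2 * i - 2] and O_i when [s = 2 * i - 1].
    Membership becomes a sum of indicators over [k], so exchanging sums turns edge counts into sums
    of degrees. *)
Definition antidiag (s k : nat) : point := (s%:Z - k%:Z, k%:Z).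

Lemma sum_antidiag (s m : nat) (p : point) :
  (\sum_(k < m) (p == antidiag s k))%N
  = [&& 0 <= p.2, p.2 < m%:Z & p.1 + p.2 == s%:Z].
Proof.
case: p => x y /=; elim: m => [|m IH]; first by rewrite big_ord0; lia.
by rewrite big_ord_recr /= IH xpair_eqE; lia.
Qed.

Lemma vE_antidiag n i p : (1 <= i <= 2 * n)%N ->
  vE n i p = (\sum_(k < i) (p == antidiag (2 * i - 2) k))%N :> nat.
Proof. by case: p => x y ?; rewrite sum_antidiag /vE /vertex /=; lia. Qed.

Lemma vO_antidiag n i p : (1 <= i <= 2 * n - 1)%N ->
  vO n i p = (\sum_(k < i) (p == antidiag (2 * i - 1) k))%N :> nat.
Proof. by case: p => x y ?; rewrite sum_antidiag /vO /vertex /=; lia. Qed.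

(** A unit step changes x + y by one, and the only external edge that can end on E_i is the one
    hanging from [base i]. *)
Lemma edge_to_even n i u v : (2 <= i <= 2 * n - 1)%N -> edge n u v ->
  vE n i v = ((vO n i u && vE n i v) + (vO n i.-1 u && vE n i v)
              + ((u, v) == (below (base i), base i)))%N :> nat.
Proof.
case: u v => [a b] [c d] hi; rewrite !xpair_eqE.
case=> [|[j hj [[-> -> -> ->]|[-> -> -> ->]]]];
by rewrite /internal_edge /vE /vO /vertex /=; lia.
Qed.

(** External edges are attached to vertices with x + y even and their free ends are not vertices, so
    none leaves O_i. *)
Lemma edge_from_odd n i u v : (1 <= i <= 2 * n - 1)%N -> edge n u v ->
  vO n i u = ((vO n i u && vE n i v) + (vO n i u && vE n i.+1 v))%N :> nat.
Proof.
case: u v => [a b] [c d] hi.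
case=> [|[j hj [[-> -> -> ->]|[-> -> -> ->]]]];
by rewrite /internal_edge /vE /vO /vertex /=; lia.
Qed.

(** The left and upper neighbours of [vL i] violate x >= y, and external edges only meet ordinates 0
    and -1. *)
Lemma edge_to_left n i u : (2 <= i <= 2 * n - 1)%N -> edge n u (vL i) ->
  u = below (vL i) \/ u = right_of (vL i).
Proof.
case: u => a b hi.
case=> [|[j hj [[]|[]]]]; rewrite /internal_edge /vertex /=; [|lia..].
move=> h; have [[-> ->]|[-> ->]] : (a = i%:Z - 1 /\ b = i%:Z - 1 - 1)
    \/ (a = i%:Z - 1 + 1 /\ b = i%:Z - 1) by lia.
  by left.
by right.
Qed.

Section Configuration.

Variables (n : nat) (sigma tau pi : seq bool) (f : {fset dart}).
Hypothesis f_tfpl : oriented_tfpl n sigma tau pi f.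

Let f_edge a : a \in f -> edge n a.1 a.2.
Proof. by case: a => u v /(tfpl_subgraph f_tfpl)[]. Qed.

Let f_antisym u v : (u, v) \in f -> (v, u) \notin f.
Proof. by case/(tfpl_subgraph f_tfpl). Qed.

(** [2 * k < s] keeps off the left boundary x = y, and [s < 4 * n - 2] off the right boundary x + y
    = 4n - 2. *)
Lemma antidiag_degrees s k : (s < 4 * n - 2)%N -> (2 * k < s)%N ->
  indegree f (antidiag s k) = 1%N /\ outdegree f (antidiag s k) = 1%N.
Proof.
move=> hs hk; apply: (tfpl_degrees f_tfpl) => [|j hj].
  by rewrite /vertex /=; lia.
by rewrite /antidiag /vL /vR; split=> -[]; lia.
Qed.

Lemma indegree_left i : (2 <= i <= 2 * n - 1)%N ->
  (indegree f (vL i) + letter sigma i = 1)%N.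
Proof.
move=> hi; have hi' : (2 <= i <= 2 * n)%N by lia.
have -> : indegree f (vL i) = ((below (vL i), vL i) \in f) :> nat.
  rewrite -sum_eq_mem /indegree card_fset_sum.
  apply: eq_big_seq => -[u v] uvf /=; rewrite xpair_eqE andbC.
  case: (v =P vL i) uvf => //= -> uvf.
  have [->|eu] := @edge_to_left n i u hi (f_edge uvf); first by rewrite eqxx.
  (* The prescribed horizontal edge leaves [vL i], so its reverse is not in [f]. *)
  have := tfpl_left_horizontal f_tfpl (i := i).
  by rewrite -eu => /(_ ltac:(lia)) /f_antisym; rewrite uvf.
have [[h0 h1] h2] := tfpl_left_vertical f_tfpl hi'.
have := letter_le1 sigma i; case: (boolP (_ \in f)) => [inf|ninf].
  by rewrite h0 // /has_edge inf.
case: (letter sigma i =P 0%N) => [/h1/h2|]; last by lia.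
by rewrite (negPf ninf).
Qed.

Lemma external_up i : (1 <= i <= 2 * n)%N ->
  (((below (base i), base i) \in f) + letter pi i = 1)%N.
Proof.
move=> hi; have [_ h0 h1] := tfpl_external f_tfpl hi.
have := letter_le1 pi i; case e: (letter pi i) => [|[|//]] _.
  by rewrite h0.
by rewrite (negPf (f_antisym (h1 e))).
Qed.

Lemma card_into_even i : (2 <= i <= 2 * n - 1)%N ->
  (\sum_(a <- f) vE n i a.2 + letter sigma i = i)%N.
Proof.
move=> hi; have hi' : (1 <= i <= 2 * n)%N by lia.
under eq_bigr do rewrite (vE_antidiag _ hi').
rewrite exchange_big /=.
under eq_bigr do rewrite -card_fset_sum -/(indegree f _).
(* The last index gives the left boundary vertex; all the others avoid both boundaries and have
   indegree 1. *)
case: i hi hi' => // i hi _; rewrite big_ord_recr /=.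
rewrite (eq_bigr (fun=> 1%N)); last first.
  move=> k _; have hk := ltn_ord k.
  by case: (@antidiag_degrees (2 * i.+1 - 2) k); lia.
rewrite sum_nat_const card_ord.
have -> : antidiag (2 * i.+1 - 2) i = vL i.+1.
  by rewrite /antidiag /vL; congr (_, _); lia.
by have := indegree_left hi; lia.
Qed.

(** Boundary vertices have x + y even, so each of the i vertices of O_i has outdegree 1. *)
Lemma card_from_odd i : (1 <= i <= 2 * n - 1)%N ->
  (\sum_(a <- f) vO n i a.1 = i)%N.
Proof.
move=> hi; under eq_bigr do rewrite vO_antidiag //.
rewrite exchange_big /=.
under eq_bigr do rewrite -card_fset_sum -/(outdegree f _).
rewrite (eq_bigr (fun=> 1%N)); first by rewrite sum_nat_const card_ord muln1.
move=> k _; have hk := ltn_ord k.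
by case: (@antidiag_degrees (2 * i - 1) k); lia.
Qed.

(** The only candidate runs from (1, 0) to (0, 0), against the prescribed edge leaving [vL 1]. *)
Lemma num_OE1 : (1 <= n)%N -> num_OE n f 1 = 0%N.
Proof.
move=> n1; rewrite /num_OE /= card_fset_sum big_seq big1 // => -[u v] uvf.
apply/eqP; rewrite eqb0; apply/negP => /=.
case: u v uvf => [a b] [c d] uvf; rewrite /vO /vE /vertex /= => h.
have := tfpl_left_horizontal f_tfpl (i := 1) ltac:(lia).
move/f_antisym/negP; apply; move: uvf; rewrite /vL /right_of /=.
have [-> [-> [-> ->]]] : a = 1 /\ b = 0 /\ c = 0 /\ d = 0 by lia.
by [].
Qed.

Lemma num_OE_recurrence i : (2 <= i <= 2 * n - 1)%N ->
  (num_OE n f i + letter sigma i = num_OE n f i.-1 + letter pi i)%N.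
Proof.
move=> hi; have hO := @card_from_odd i.-1 ltac:(lia).
have hE := card_into_even hi; have hx := @external_up i ltac:(lia).
have hi1 : (1 <= i.-1 <= 2 * n - 1)%N by lia.
rewrite (eq_big_seq _ (fun a af => edge_to_even hi (f_edge af))) in hE.
rewrite (eq_big_seq _ (fun a af => edge_from_odd hi1 (f_edge af))) in hO.
have external : (\sum_(a <- f) ((a.1, a.2) == (below (base i), base i))
                 = ((below (base i), base i) \in f))%N.
  by rewrite -sum_eq_mem; apply: eq_bigr => -[].
move: hE hO; rewrite !big_split /= external (_ : i.-1.+1 = i); last by lia.
have numE j : (1 <= j)%N ->
    num_OE n f j = (\sum_(a <- f) (vO n j a.1 && vE n j a.2))%N.
  by case: j => // j _; rewrite /num_OE card_fset_sum.
rewrite !numE; [|lia..] => hE hO.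
(* Here [x] and [z] stand for N_i and N_(i-1), [y] for the number of edges from O_(i-1) to E_i, [o]
   for the upward external edge, [s] and [p] for the letters of [sigma] and [pi]. *)
have eliminate (x y z o s p : nat) : (x + y + o + s = i -> z + y = i.-1 ->
    o + p = 1 -> x + s = z + p)%N by lia.
exact: eliminate hE hO hx.
Qed.

End Configuration.

Theorem lemma4p5 (n : nat) (sigma tau pi : seq bool) (f : {fset dart})
    (n_ge1 : (1 <= n)%N)
    (sigma_dyck : dyck n sigma) (tau_dyck : dyck n tau) (pi_dyck : dyck n pi)
    (f_tfpl : oriented_tfpl n sigma tau pi f)
    (i : nat) (i_range : (1 <= i <= 2 * n - 1)%N) :
  (num_OE n f i)%:Z - (num_OE n f i.-1)%:Z
  = (letter pi i)%:Z - (letter sigma i)%:Z.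
Proof.
(* The recurrence starts at 2 because [sigma] prescribes no vertical edge at [vL 1]. *)
case: (ltnP 1 i) => [i_gt1|i_le1].
  by have := num_OE_recurrence f_tfpl (i := i) ltac:(lia); lia.
have -> : i = 1%N by lia.
by rewrite (num_OE1 f_tfpl n_ge1) (dyck_letter1 sigma_dyck) (dyck_letter1 pi_dyck).
Qed.
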